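(* Let $(\mathcal J,E)$ be a marked 2-category, $\mathcal C$ a 2-category and $F\colon\mathcal J\to\mathcal C$ a 2-functor. If $(\ell,\lambda)$ is an $E$-bilimit of $F$, then $(\ell,\lambda)$ is a biterminal object in $(\mathcal C^{/F}_E)_{\mathrm{cart}}$.
   Context: Conventions. 2-categories and 2-functors are strict. Composition of 1-cells and whiskering are written by juxtaposition; $\beta\circ\alpha$ is vertical composition of 2-cells (first $\alpha$, then $\beta$). A marked 2-category $(\mathcal J,E)$ is a 2-category with a class $E$ of 1-cells containing all identities. $E$-lax cones. An $E$-lax cone $(x,\alpha)$ over $F\colon\mathcal J\to\mathcal C$ is an object $x$ of $\mathcal C$, 1-cells $\alpha_i\colon x\to Fi$ for each object $i$, and 2-cells $\alpha_k\colon F(k)\alpha_i\to\alpha_j$ for each 1-cell $k\colon i\to j$ of $\mathcal J$, such that $\alpha_{1_i}=1_{\alpha_i}$; $\alpha_{hk}=\alpha_h\circ(F(h)\alpha_k)$; $\alpha_k=\alpha_{k'}\circ(F(\Lambda)\alpha_i)$ for each 2-cell $\Lambda\colon k\to k'$; and $\alpha_k$ is invertible for $k\in E$. For fixed $x$, these are the objects of a category $[\mathcal J,\mathcal C]_E(\Delta x,F)$ whose morphisms $\beta\to\alpha$ are the modifications: families of 2-cells $\mu_i\colon\beta_i\to\alpha_i$ with $\alpha_k\circ(F(k)\mu_i)=\mu_j\circ\beta_k$ for all $k\colon i\to j$. $E$-bilimit. An $E$-lax cone $(\ell,\lambda)$ is an $E$-bilimit of $F$ if for every object $x$ of $\mathcal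 C$ the functor $\mathcal C(x,\ell)\to[\mathcal J,\mathcal C]_E(\Delta x,F)$, $f\mapsto\lambda\cdot f$ (with components $\lambda_i f$ and $\lambda_k f$), $\zeta\mapsto(\lambda_i\zeta)_i$, is an equivalence of categories. 2-category of cones $\mathcal C^{/F}_E$. Objects: $E$-lax cones $(x,\alpha)$ over $F$. 1-cells $(x,\alpha)\to(y,\beta)$: pairs $(f,\mu)$ with $f\colon x\to y$ and 2-cells $\mu_i\colon\beta_i f\to\alpha_i$ such that $\alpha_k\circ(F(k)\mu_i)=\mu_j\circ(\beta_k f)$ for all $k\colon i\to j$. 2-cells $(f,\mu)\to(g,\delta)$: 2-cells $\Xi\colon f\to g$ of $\mathcal C$ with $\delta_i\circ(\beta_i\Xi)=\mu_i$ for all $i$. Composition of 1-cells: $(g,\nu)(f,\mu)=(gf,\ (\mu_i\circ(\nu_i f))_i)$; the rest is inherited from $\mathcal C$. Let $p\colon\mathcal C^{/F}_E\to\mathcal C$ be the projection $(x,\alpha)\mapsto x$, $(f,\mu)\mapsto f$, $\Xi\mapsto\Xi$. For a 2-functor $p\colon\mathcal E\to\mathcal B$, a 1-cell $f\colon u\to v$ of $\mathcal E$ is $p$-cartesian if for every object $a$ of $\mathcal E$ the square with $f\circ-\colon\mathcal E(a,u)\to\mathcal E(a,v)$ over $p(f)\circ-\colon\mathcal B(pa,pu)\to\mathcal B(pa,pv)$ is a (strict) pullback of categories. The sub-2-category $\mathcal E_{\mathrm{cart}}\subseteq\mathcal E$ has all objects of $\mathcal E$, and $\mathcal E_{\mathrm{cart}}(u,v)$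 is the full subcategory of $\mathcal E(u,v)$ spanned by the $p$-cartesian 1-cells. An object $t$ of a 2-category $\mathcal D$ is biterminal if for every object $z$ the category $\mathcal D(z,t)$ is equivalent to the terminal category. *)

(* Defs.v *)
From Stdlib Require Import FunctionalExtensionality ProofIrrelevance.

Set Implicit Arguments.
Unset Strict Implicit.
Unset Printing Implicit Defensive.

Record category := Category {
  obj :> Type;
  mor : obj -> obj -> Type;
  idm : forall a, mor a a;
  vcomp : forall a b c, mor b c -> mor a b -> mor a c;
  vcomp_idl : forall a b (f : mor a b), vcomp (idm b) f = f;
  vcomp_idr : forall a b (f : mor a b), vcomp f (idm a) = f;
  vcomp_assoc : forall a b c d (h : mor c d) (g : mor b c) (f : mor a b),
    vcomp h (vcomp g f) = vcomp (vcomp h g) f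
}.
Arguments mor {_} _ _.
Arguments idm {_} _.
Notation "g ∘ f" := (vcomp g f) (at level 40, left associativity).

Definition is_iso (A : category) (a b : A) (f : mor a b) : Prop :=
  exists g : mor b a, g ∘ f = idm a /\ f ∘ g = idm b.

(** Strict equality of morphisms whose endpoints are equal, but not necessarily
    by conversion: [f ≡ g] means that the sources agree, the targets agree, and
    [f] and [g] agree after transport. *)
Inductive mor_eq (A : category) (a b : A) (f : mor a b) :
    forall c d : A, mor c d -> Prop :=
  mor_eq_refl : mor_eq f f.
Notation "f ≡ g" := (mor_eq f g) (at level 70, no associativity).

(** An equality of objects regarded as an identity morphism. *)
Definition id_of_eq (A : category) (a b : A) (e : a = b) : mor a b :=
  match e with eq_refl => idm a end.

Section MorEq.
Context (A : category).

Lemma meq_dom (a b c d : A) (f : mor a b) (g : mor c d) : f ≡ g -> a = c.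
Proof. now intros []. Qed.

Lemma meq_cod (a b c d : A) (f : mor a b) (g : mor c d) : f ≡ g -> b = d.
Proof. now intros []. Qed.

Lemma meq_eq (a b : A) (f g : mor a b) : f ≡ g -> f = g.
Proof.
intro H.
assert (K : forall c d (h : mor c d) (p : a = c) (q : b = d), f ≡ h ->
  eq_rect b (fun y => mor c y) (eq_rect a (fun x => mor x b) f c p) d q = h).
{ intros c d h p q Hh. destruct Hh.
  now rewrite (proof_irrelevance _ p eq_refl), (proof_irrelevance _ q eq_refl). }
exact (K a b g eq_refl eq_refl H).
Qed.

Lemma eq_meq (a b : A) (f g : mor a b) : f = g -> f ≡ g.
Proof. intros ->; constructor. Qed.

Lemma meq_sym (a b c d : A) (f : mor a b) (g : mor c d) : f ≡ g -> g ≡ f.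
Proof. intros []; constructor. Qed.

Lemma meq_trans (a b c d a' b' : A) (f : mor a b) (g : mor c d) (h : mor a' b') :
  f ≡ g -> g ≡ h -> f ≡ h.
Proof. intros [] H; exact H. Qed.

Lemma meq_vcomp (a b c a' b' c' : A) (g : mor b c) (f : mor a b)
    (g' : mor b' c') (f' : mor a' b') :
  g ≡ g' -> f ≡ f' -> g ∘ f ≡ g' ∘ f'.
Proof.
intros Hg Hf.
pose proof (meq_dom Hf); pose proof (meq_dom Hg); pose proof (meq_cod Hg).
subst. apply meq_eq in Hg; apply meq_eq in Hf; subst; constructor.
Qed.

Lemma meq_idm (a b : A) : a = b -> idm a ≡ idm b.
Proof. intros ->; constructor. Qed.

Lemma meq_cast (a b : A) (e : a = b) : id_of_eq e ≡ idm a.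
Proof. destruct e; constructor. Qed.

Lemma meq_cast' (a b : A) (e : a = b) : id_of_eq e ≡ idm b.
Proof. destruct e; constructor. Qed.

Lemma meq_castl (a b c : A) (e : b = c) (f : mor a b) : id_of_eq e ∘ f ≡ f.
Proof. destruct e; apply eq_meq, vcomp_idl. Qed.

Lemma meq_castr (a b c : A) (e : a = b) (f : mor b c) : f ∘ id_of_eq e ≡ f.
Proof. destruct e; apply eq_meq, vcomp_idr. Qed.

Lemma is_iso_castr (a b c : A) (e : a = b) (f : mor b c) :
  is_iso f -> is_iso (f ∘ id_of_eq e).
Proof. destruct e; cbn; now rewrite vcomp_idr. Qed.

End MorEq.

Record functor (A B : category) := Functor {
  fobj :> A -> B;
  fmor : forall a b, mor a b -> mor (fobj a) (fobj b);
  fmor_id : forall a, fmor (idm a) = idm (fobj a);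
  fmor_comp : forall a b c (g : mor b c) (f : mor a b),
    fmor (g ∘ f) = fmor g ∘ fmor f
}.
Arguments fmor {_ _} _ {_ _} _.

Lemma meq_fmor (A B : category) (F : functor A B) (a b c d : A)
    (f : mor a b) (g : mor c d) : f ≡ g -> fmor F f ≡ fmor F g.
Proof. intros []; constructor. Qed.

Lemma is_iso_fmor (A B : category) (F : functor A B) (a b : A) (f : mor a b) :
  is_iso f -> is_iso (fmor F f).
Proof.
intros [g [H1 H2]]; exists (fmor F g).
now rewrite <- !fmor_comp, H1, H2, !fmor_id.
Qed.

Definition id_functor (A : category) : functor A A.
Proof. now refine (@Functor A A (fun a => a) (fun a b f => f) _ _). Defined.

Definition comp_functor (A B C : category) (G : functor B C) (F : functor A B) :
  functor A C.
Proof.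
refine (@Functor A C (fun a => G (F a)) (fun a b f => fmor G (fmor F f)) _ _).
- intro a; now rewrite !fmor_id.
- intros; now rewrite !fmor_comp.
Defined.

(** Strict equality of functors. *)
Definition functor_eq (A B : category) (F G : functor A B) : Prop :=
  (forall a, F a = G a) /\
  (forall a b (f : mor a b), fmor F f ≡ fmor G f).

Definition nat_iso (A B : category) (F G : functor A B) : Prop :=
  exists eta : forall a, mor (F a) (G a),
    (forall a b (f : mor a b), fmor G f ∘ eta a = eta b ∘ fmor F f) /\
    (forall a, is_iso (eta a)).

Definition is_equivalence (A B : category) (F : functor A B) : Prop :=
  exists G : functor B A,
    nat_iso (comp_functor G F) (id_functor A) /\
    nat_iso (comp_functor F G) (id_functor B).

Definition equivalent (A B : category) : Prop :=
  exists F : functor A B, is_equivalence F.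

Definition terminal_cat : category.
Proof.
refine (@Category unit (fun _ _ => unit) (fun _ => tt) (fun _ _ _ _ _ => tt) _ _ _).
- now intros ? ? [].
- now intros ? ? [].
- reflexivity.
Defined.

Definition prod_cat (A B : category) : category.
Proof.
refine (@Category (A * B)%type
  (fun a b => (mor (fst a) (fst b) * mor (snd a) (snd b))%type)
  (fun a => (idm (fst a), idm (snd a)))
  (fun a b c g f => (fst g ∘ fst f, snd g ∘ snd f)) _ _ _).
- intros a b [f g]; cbn; now rewrite !vcomp_idl.
- intros a b [f g]; cbn; now rewrite !vcomp_idr.
- intros; cbn; now rewrite !vcomp_assoc.
Defined.

Definition full_subcat (A : category) (P : A -> Prop) : category.
Proof.
refine (@Category {a : A | P a} (fun a b => mor (proj1_sig a) (proj1_sig b))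
  (fun a => idm (proj1_sig a)) (fun a b c g f => g ∘ f) _ _ _).
- intros; apply vcomp_idl.
- intros; apply vcomp_idr.
- intros; apply vcomp_assoc.
Defined.

(** The square [G ∘ P = K ∘ Q] is a pullback in the 1-category of categories. *)
Definition is_pullback (A B C D : category) (P : functor A B) (Q : functor A C)
    (G : functor B D) (K : functor C D) : Prop :=
  functor_eq (comp_functor G P) (comp_functor K Q) /\
  forall (X : category) (H : functor X B) (L : functor X C),
    functor_eq (comp_functor G H) (comp_functor K L) ->
    exists U : functor X A,
      (functor_eq (comp_functor P U) H /\ functor_eq (comp_functor Q U) L) /\
      forall V : functor X A,
        functor_eq (comp_functor P V) H -> functor_eq (comp_functor Q V) L ->
        functor_eq V U.

(** A category enriched in categories: the 1-cells and 2-cells [x -> y] are the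
    objects and morphisms of [hom x y], composed vertically by [∘]. *)
Record two_cat := TwoCat {
  cell0 :> Type;
  hom : cell0 -> cell0 -> category;
  id1 : forall x, hom x x;
  hcomp : forall x y z, functor (prod_cat (hom y z) (hom x y)) (hom x z);
  comp1_idl : forall x y (f : hom x y), hcomp x y y (id1 y, f) = f;
  comp1_idr : forall x y (f : hom x y), hcomp x x y (f, id1 x) = f;
  comp1_assoc : forall x y z w (h : hom z w) (g : hom y z) (f : hom x y),
    hcomp x z w (h, hcomp x y z (g, f)) = hcomp x y w (hcomp y z w (h, g), f);
  comp2_idl : forall x y (f g : hom x y) (a : mor f g),
    @fmor _ _ (hcomp x y y) (id1 y, f) (id1 y, g) (idm (id1 y), a) ≡ a;
  comp2_idr : forall x y (f g : hom x y) (a : mor f g),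
    @fmor _ _ (hcomp x x y) (f, id1 x) (g, id1 x) (a, idm (id1 x)) ≡ a;
  comp2_assoc : forall x y z w (h h' : hom z w) (g g' : hom y z) (f f' : hom x y)
      (c : mor h h') (b : mor g g') (a : mor f f'),
    @fmor _ _ (hcomp x z w) (h, hcomp x y z (g, f)) (h', hcomp x y z (g', f'))
      (c, @fmor _ _ (hcomp x y z) (g, f) (g', f') (b, a))
    ≡ @fmor _ _ (hcomp x y w) (hcomp y z w (h, g), f) (hcomp y z w (h', g'), f')
        (@fmor _ _ (hcomp y z w) (h, g) (h', g') (c, b), a)
}.
Arguments id1 {_} _.

Definition comp1 (C : two_cat) (x y z : C) (g : hom y z) (f : hom x y) : hom x z :=
  hcomp x y z (g, f).
Notation "g · f" := (comp1 g f) (at level 30, right associativity).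

Definition comp2 (C : two_cat) (x y z : C) (g g' : hom y z) (f f' : hom x y)
    (b : mor g g') (a : mor f f') : mor (g · f) (g' · f') :=
  @fmor _ _ (hcomp x y z) (g, f) (g', f') (b, a).
Notation "b ∗ a" := (comp2 b a) (at level 30, right associativity).
Notation "h ◁ a" := (comp2 (idm h) a) (at level 30, right associativity).
Notation "b ▷ f" := (comp2 b (idm f)) (at level 30, right associativity).

Section TwoCat.
Context (C : two_cat).

Lemma assoc1 (x y z w : C) (h : hom z w) (g : hom y z) (f : hom x y) :
  h · (g · f) = (h · g) · f.
Proof. apply comp1_assoc. Qed.

Lemma idl1 (x y : C) (f : hom x y) : id1 y · f = f.
Proof. apply comp1_idl. Qed.

Lemma idr1 (x y : C) (f : hom x y) : f · id1 x = f.
Proof. apply comp1_idr. Qed.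

Lemma assoc2 (x y z w : C) (h h' : hom z w) (g g' : hom y z) (f f' : hom x y)
    (c : mor h h') (b : mor g g') (a : mor f f') :
  c ∗ (b ∗ a) ≡ (c ∗ b) ∗ a.
Proof. apply comp2_assoc. Qed.

Lemma idl2 (x y : C) (f g : hom x y) (a : mor f g) : id1 y ◁ a ≡ a.
Proof. apply comp2_idl. Qed.

Lemma idr2 (x y : C) (f g : hom x y) (a : mor f g) : a ▷ id1 x ≡ a.
Proof. apply comp2_idr. Qed.

Lemma comp2_idm (x y z : C) (g : hom y z) (f : hom x y) :
  idm g ∗ idm f = idm (g · f).
Proof. exact (fmor_id (hcomp x y z) (g, f)). Qed.

Lemma interchange (x y z : C) (g g' g'' : hom y z) (f f' f'' : hom x y)
    (b' : mor g' g'') (b : mor g g') (a' : mor f' f'') (a : mor f f') :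
  (b' ∘ b) ∗ (a' ∘ a) = (b' ∗ a') ∘ (b ∗ a).
Proof.
exact (@fmor_comp _ _ (hcomp x y z) (g, f) (g', f') (g'', f'') (b', a') (b, a)).
Qed.

Lemma lwhisk (x y z : C) (h : hom y z) (f f' f'' : hom x y)
    (a' : mor f' f'') (a : mor f f') : h ◁ (a' ∘ a) = (h ◁ a') ∘ (h ◁ a).
Proof. now rewrite <- interchange, vcomp_idl. Qed.

Lemma rwhisk (x y z : C) (g g' g'' : hom y z) (f : hom x y)
    (b' : mor g' g'') (b : mor g g') : (b' ∘ b) ▷ f = (b' ▷ f) ∘ (b ▷ f).
Proof. now rewrite <- interchange, vcomp_idl. Qed.

Lemma comp2_lr (x y z : C) (g g' : hom y z) (f f' : hom x y)
    (b : mor g g') (a : mor f f') : b ∗ a = (b ▷ f') ∘ (g ◁ a).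
Proof. now rewrite <- interchange, vcomp_idl, vcomp_idr. Qed.

Lemma comp2_rl (x y z : C) (g g' : hom y z) (f f' : hom x y)
    (b : mor g g') (a : mor f f') : b ∗ a = (g' ◁ a) ∘ (b ▷ f).
Proof. now rewrite <- interchange, vcomp_idl, vcomp_idr. Qed.

Lemma meq_comp2 (x y z : C) (g g' k k' : hom y z) (f f' l l' : hom x y)
    (b : mor g g') (a : mor f f') (d : mor k k') (c : mor l l') :
  b ≡ d -> a ≡ c -> b ∗ a ≡ d ∗ c.
Proof. intros [] []; constructor. Qed.

Lemma is_iso_rwhisk (x y z : C) (g g' : hom y z) (f : hom x y) (b : mor g g') :
  is_iso b -> is_iso (b ▷ f).
Proof.
intros [c [H1 H2]]; exists (c ▷ f).
now rewrite <- !rwhisk, H1, H2, !comp2_idm.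
Qed.

Definition postcomp (a u v : C) (f : hom u v) : functor (hom a u) (hom a v).
Proof.
refine (@Functor (hom a u) (hom a v) (fun g => f · g) (fun g g' t => f ◁ t) _ _).
- intro g; apply comp2_idm.
- intros; apply lwhisk.
Defined.

Definition biterminal (t : C) : Prop :=
  forall z : C, equivalent (hom z t) terminal_cat.

End TwoCat.

Lemma meq_full (A : category) (P : A -> Prop) (a b c d : full_subcat P)
    (f : mor a b) (g : mor c d) :
  @mor_eq A (proj1_sig a) (proj1_sig b) f (proj1_sig c) (proj1_sig d) g -> f ≡ g.
Proof.
destruct a as [a pa], b as [b pb], c as [c pc], d as [d pd]; cbn in *.
intro H; pose proof (meq_dom H); pose proof (meq_cod H); subst c d.
apply meq_eq in H; subst g.
rewrite (proof_irrelevance _ pc pa), (proof_irrelevance _ pd pb); constructor.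
Qed.

(** The locally full sub-2-category on all objects and the 1-cells in [P]. *)
Definition sub_two_cat (C : two_cat) (P : forall x y : C, hom x y -> Prop)
    (P_id : forall x, P x x (id1 x))
    (P_comp : forall x y z (g : hom y z) (f : hom x y),
      P y z g -> P x y f -> P x z (g · f)) : two_cat.
Proof.
unshelve refine (@TwoCat C (fun x y => full_subcat (P x y))
  (fun x => exist _ (id1 x) (P_id x)) _ _ _ _ _ _ _).
- intros x y z.
  unshelve refine (@Functor (prod_cat (full_subcat (P y z)) (full_subcat (P x y)))
    (full_subcat (P x z))
    (fun gf => exist _ (proj1_sig (fst gf) · proj1_sig (snd gf))
      (P_comp _ _ _ _ _ (proj2_sig (fst gf)) (proj2_sig (snd gf))))
    (fun gf gf' ba => fst ba ∗ snd ba) _ _).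
  + intros [g f]; apply comp2_idm.
  + intros; apply interchange.
- intros x y [f pf]; apply eq_sig_hprop; [intros; apply proof_irrelevance | apply idl1].
- intros x y [f pf]; apply eq_sig_hprop; [intros; apply proof_irrelevance | apply idr1].
- intros x y z w [h ph] [g pg] [f pf].
  apply eq_sig_hprop; [intros; apply proof_irrelevance | apply assoc1].
- intros; apply meq_full, idl2.
- intros; apply meq_full, idr2.
- intros; apply meq_full, assoc2.
Defined.

Record two_functor (C D : two_cat) := TwoFunctor {
  on0 :> C -> D;
  on_hom : forall x y, functor (hom x y) (hom (on0 x) (on0 y));
  on1_id : forall x, on_hom x x (id1 x) = id1 (on0 x);
  on1_comp : forall x y z (g : hom y z) (f : hom x y),
    on_hom x z (g · f) = on_hom y z g · on_hom x y f;
  on2_comp : forall x y z (g g' : hom y z) (f f' : hom x y)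
      (b : mor g g') (a : mor f f'),
    fmor (on_hom x z) (b ∗ a) ≡ fmor (on_hom y z) b ∗ fmor (on_hom x y) a
}.

Definition on1 (C D : two_cat) (F : two_functor C D) (x y : C) (f : hom x y) :
  hom (F x) (F y) := on_hom F x y f.
Definition on2 (C D : two_cat) (F : two_functor C D) (x y : C) (f g : hom x y)
  (a : mor f g) : mor (on1 F f) (on1 F g) := fmor (on_hom F x y) a.

Definition is_cartesian (E B : two_cat) (p : two_functor E B) (u v : E)
    (f : hom u v) : Prop :=
  forall a : E,
    is_pullback (postcomp a f) (on_hom p a u)
      (on_hom p a v) (postcomp (p a) (on1 p f)).

Lemma feq_refl (A B : category) (F : functor A B) : functor_eq F F.
Proof. split; intros; constructor. Qed.

Lemma feq_sym (A B : category) (F G : functor A B) : functor_eq F G -> functor_eq G F.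
Proof. intros [H1 H2]; split; intros; [symmetry | apply meq_sym]; auto. Qed.

Lemma feq_trans (A B : category) (F G H : functor A B) :
  functor_eq F G -> functor_eq G H -> functor_eq F H.
Proof.
intros [H1 H2] [K1 K2]; split; intros.
- now rewrite H1.
- eapply meq_trans; [apply H2 | apply K2].
Qed.

Lemma feq_whl (A B C : category) (K : functor B C) (F G : functor A B) :
  functor_eq F G -> functor_eq (comp_functor K F) (comp_functor K G).
Proof.
intros [H1 H2]; split; cbn; intros; [now rewrite H1 | now apply meq_fmor].
Qed.

Lemma feq_whr (A B C : category) (F G : functor B C) (K : functor A B) :
  functor_eq F G -> functor_eq (comp_functor F K) (comp_functor G K).
Proof. intros [H1 H2]; split; cbn; intros; auto. Qed.

Lemma postcomp_id (C : two_cat) (a x : C) :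
  functor_eq (postcomp a (id1 x)) (id_functor (hom a x)).
Proof. split; cbn; intros; [apply idl1 | apply idl2]. Qed.

Lemma postcomp_comp (C : two_cat) (a x y z : C) (g : hom y z) (f : hom x y) :
  functor_eq (postcomp a (g · f)) (comp_functor (postcomp a g) (postcomp a f)).
Proof.
split; cbn; intros.
- symmetry; apply assoc1.
- rewrite <- comp2_idm; apply meq_sym, assoc2.
Qed.

Lemma postcomp_eq (C : two_cat) (a x y : C) (g f : hom x y) : g = f ->
  functor_eq (postcomp a g) (postcomp a f).
Proof. intros ->; apply feq_refl. Qed.

Lemma postcomp_square (E B : two_cat) (p : two_functor E B) (a u v : E)
    (f : hom u v) :
  functor_eq (comp_functor (on_hom p a v) (postcomp a f))
    (comp_functor (postcomp (p a) (on1 p f)) (on_hom p a u)).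
Proof.
split; cbn; intros.
- apply on1_comp.
- eapply meq_trans; [apply on2_comp | rewrite fmor_id; constructor].
Qed.

Lemma is_cartesian_id (E B : two_cat) (p : two_functor E B) (u : E) :
  is_cartesian p (id1 u).
Proof.
intro a; split; [apply postcomp_square |].
intros X H L HL.
assert (Q : functor_eq (postcomp (p a) (on1 p (id1 u))) (id_functor _)).
{ eapply feq_trans; [apply postcomp_eq, on1_id | apply postcomp_id]. }
exists H; split; [split |].
- exact (feq_whr H (postcomp_id a u)).
- exact (feq_trans HL (feq_whr L Q)).
- intros V HV _.
  exact (feq_trans (feq_sym (feq_whr V (postcomp_id a u))) HV).
Qed.

Lemma is_cartesian_comp (E B : two_cat) (p : two_functor E B) (u v w : E)
    (g : hom v w) (f : hom u v) :
  is_cartesian p g -> is_cartesian p f -> is_cartesian p (g · f).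
Proof.
intros Cg Cf a; split; [apply postcomp_square |].
intros X H L HL.
assert (Q : functor_eq (postcomp (p a) (on1 p (g · f)))
  (comp_functor (postcomp (p a) (on1 p g)) (postcomp (p a) (on1 p f)))).
{ eapply feq_trans; [apply postcomp_eq, on1_comp | apply postcomp_comp]. }
pose proof (postcomp_comp a g f) as R.
destruct (Cg a) as [_ Pg], (Cf a) as [Sf Pf].
destruct (Pg X H (comp_functor (postcomp (p a) (on1 p f)) L)) as [W [[W1 W2] W3]].
{ exact (feq_trans HL (feq_whr L Q)). }
destruct (Pf X W L W2) as [U [[U1 U2] U3]].
exists U; split; [split |].
- exact (feq_trans (feq_whr U R) (feq_trans (feq_whl (postcomp a g) U1) W1)).
- exact U2.
- intros V V1 V2; apply U3; [apply W3 |]; trivial.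
  + exact (feq_trans (feq_sym (feq_whr V R)) V1).
  + exact (feq_trans (feq_whr V Sf) (feq_whl (postcomp (p a) (on1 p f)) V2)).
Qed.

Definition cart_two_cat (E B : two_cat) (p : two_functor E B) : two_cat :=
  @sub_two_cat E (fun u v f => is_cartesian p f)
    (@is_cartesian_id E B p) (@is_cartesian_comp E B p).

Record marking (J : two_cat) := Marking {
  marked : forall i j : J, hom i j -> Prop;
  marked_id : forall i, marked (id1 i)
}.
Arguments marked {_} _ {_ _} _.

Section Cones.
Context (J : two_cat) (E : marking J) (C : two_cat) (F : two_functor J C).

Record lax_cone (x : C) := LaxCone {
  leg : forall i : J, hom x (F i);
  leg2 : forall (i j : J) (k : hom i j), mor (on1 F k · leg i) (leg j);
  leg2_id : forall i, leg2 (id1 i) ≡ idm (leg i);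
  leg2_comp : forall (i j l : J) (h : hom j l) (k : hom i j),
    leg2 (h · k) ≡ leg2 h ∘ (on1 F h ◁ leg2 k);
  leg2_nat : forall (i j : J) (k k' : hom i j) (L : mor k k'),
    leg2 k = leg2 k' ∘ (on2 F L ▷ leg i);
  leg2_marked : forall (i j : J) (k : hom i j), marked E k -> is_iso (leg2 k)
}.

Record modification (x : C) (b a : lax_cone x) := Modification {
  modif : forall i, mor (leg b i) (leg a i);
  modif_law : forall (i j : J) (k : hom i j),
    leg2 a k ∘ (on1 F k ◁ modif i) = modif j ∘ leg2 b k
}.

Lemma modification_eq (x : C) (b a : lax_cone x) (m n : modification b a) :
  (forall i, modif m i = modif n i) -> m = n.
Proof.
destruct m as [m hm], n as [n hn]; cbn; intro H.
assert (m = n) by (apply functional_extensionality_dep, H); subst.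
now rewrite (proof_irrelevance _ hm hn).
Qed.

Definition cone_cat (x : C) : category.
Proof.
unshelve refine (@Category (lax_cone x) (@modification x) _ _ _ _ _).
- intro a; refine (@Modification x a a (fun i => idm (leg a i)) _).
  intros i j k; now rewrite comp2_idm, vcomp_idl, vcomp_idr.
- intros a b c n m.
  refine (@Modification x a c (fun i => modif n i ∘ modif m i) _).
  intros i j k; rewrite lwhisk, vcomp_assoc, modif_law.
  now rewrite <- !vcomp_assoc, modif_law.
- intros; apply modification_eq; intro; apply vcomp_idl.
- intros; apply modification_eq; intro; apply vcomp_idr.
- intros; apply modification_eq; intro; apply vcomp_assoc.
Defined.

(** The cone [a · f], with components [a_i f] and [a_k f]; the identity
    2-cell mediates between [F(k)(a_i f)] and [(F(k) a_i) f]. *)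
Definition precomp (y : C) (a : lax_cone y) (x : C) (f : hom x y) : lax_cone x.
Proof.
refine (@LaxCone x (fun i => leg a i · f)
  (fun i j k => (leg2 a k ▷ f) ∘ id_of_eq (assoc1 (on1 F k) (leg a i) f)) _ _ _ _).
- intro i. eapply meq_trans; [apply meq_castr |].
  rewrite <- comp2_idm. apply meq_comp2; [apply leg2_id | constructor].
- intros i j l h k. eapply meq_trans; [apply meq_castr |].
  eapply meq_trans.
  { apply meq_comp2; [apply leg2_comp | apply mor_eq_refl]. }
  rewrite rwhisk. apply meq_vcomp.
  + apply meq_sym, meq_castr.
  + eapply meq_trans; [apply meq_sym, assoc2 |].
    apply meq_comp2; [constructor |]. apply meq_sym, meq_castr.
- intros i j k k' L. apply meq_eq.
  eapply meq_trans; [apply meq_castr |].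
  rewrite (leg2_nat a L), rwhisk. apply meq_vcomp.
  + apply meq_sym, meq_castr.
  + rewrite <- (comp2_idm (leg a i) f). apply meq_sym, assoc2.
- intros i j k Hk. apply is_iso_castr, is_iso_rwhisk. now apply leg2_marked.
Defined.

Definition precomp_functor (y : C) (a : lax_cone y) (x : C) :
  functor (hom x y) (cone_cat x).
Proof.
unshelve refine (@Functor (hom x y) (cone_cat x) (fun f => precomp a f) _ _ _).
- intros f g z.
  refine (@Modification x (precomp a f) (precomp a g) (fun i => leg a i ◁ z) _).
  intros i j k; cbn. apply meq_eq. apply meq_trans with (g := (leg2 a k ▷ g) ∘ ((on1 F k · leg a i) ◁ z)).
  + apply meq_vcomp; [apply meq_castr |].
    eapply meq_trans; [apply assoc2 |]. rewrite comp2_idm. constructor.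
  + rewrite <- comp2_lr, comp2_rl.
    apply meq_vcomp; [constructor | apply meq_sym, meq_castr].
- intro f; apply modification_eq; intro i; cbn; apply comp2_idm.
- intros f g h b c; apply modification_eq; intro i; cbn; apply lwhisk.
Defined.

Definition is_bilimit (l : C) (lam : lax_cone l) : Prop :=
  forall x : C, is_equivalence (precomp_functor lam x).

Record cone := Cone { apex : C; legs : lax_cone apex }.

(** That [map2] is a modification [legs b · map1 -> legs a] says exactly that its
    components [mu_i] satisfy [a_k ∘ (F(k) mu_i) = mu_j ∘ (b_k f)]. *)
Record cone_map (a b : cone) := ConeMap {
  map1 : hom (apex a) (apex b);
  map2 : modification (precomp (legs b) map1) (legs a)
}.

Record cone_cell (a b : cone) (f g : cone_map a b) := ConeCell {
  cell : mor (map1 f) (map1 g);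
  cell_law : forall i,
    modif (map2 g) i ∘ (leg (legs b) i ◁ cell) = modif (map2 f) i
}.

Lemma cone_map_eq (a b : cone) (f g : cone_map a b) :
  map1 f = map1 g -> (forall i, modif (map2 f) i ≡ modif (map2 g) i) -> f = g.
Proof.
destruct f as [f m], g as [g n]; cbn; intros <- H.
f_equal; apply modification_eq; intro i; apply meq_eq, H.
Qed.

Lemma cone_cell_eq (a b : cone) (f g : cone_map a b) (s t : cone_cell f g) :
  cell s = cell t -> s = t.
Proof.
destruct s as [s hs], t as [t ht]; cbn; intros <-.
now rewrite (proof_irrelevance _ hs ht).
Qed.

Definition cone_hom (a b : cone) : category.
Proof.
unshelve refine (@Category (cone_map a b) (@cone_cell a b) _ _ _ _ _).
- intro f; refine (@ConeCell a b f f (idm (map1 f)) _).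
  intro i; rewrite comp2_idm; exact (vcomp_idr _).
- intros f g h t s; refine (@ConeCell a b f h (cell t ∘ cell s) _).
  intro i; rewrite lwhisk. etransitivity; [exact (vcomp_assoc _ _ _) |].
  rewrite (cell_law t); apply cell_law.
- intros; apply cone_cell_eq, vcomp_idl.
- intros; apply cone_cell_eq, vcomp_idr.
- intros; apply cone_cell_eq, vcomp_assoc.
Defined.

Lemma cone_cell_meq (a b : cone) (f g f' g' : cone_hom a b)
    (s : mor f g) (t : mor f' g') :
  f = f' -> g = g' -> cell s ≡ cell t -> s ≡ t.
Proof. intros <- <- H; apply eq_meq, cone_cell_eq, meq_eq, H. Qed.

Definition cone_id (a : cone) : cone_map a a.
Proof.
refine (@ConeMap a a (id1 (apex a)) (@Modification _
  (precomp (legs a) (id1 (apex a))) (legs a)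
  (fun i => id_of_eq (idr1 (leg (legs a) i))) _)).
intros i j k; cbn. apply meq_eq.
apply meq_trans with (g := leg2 (legs a) k ∘ idm _).
- apply meq_vcomp; [constructor |]. rewrite <- comp2_idm.
  apply meq_comp2; [constructor | apply meq_cast'].
- rewrite vcomp_idr. apply meq_sym.
  eapply meq_trans; [apply meq_castl |].
  eapply meq_trans; [apply meq_castr | apply idr2].
Defined.

Definition cone_comp (a b c : cone) (g : cone_map b c) (f : cone_map a b) :
  cone_map a c.
Proof.
refine (@ConeMap a c (map1 g · map1 f) (@Modification _
  (precomp (legs c) (map1 g · map1 f)) (legs a)
  (fun i => modif (map2 f) i ∘ (modif (map2 g) i ▷ map1 f)
    ∘ id_of_eq (assoc1 (leg (legs c) i) (map1 g) (map1 f))) _)).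
intros i j k.
pose proof (modif_law (map2 f) k) as Hf; cbn in Hf.
pose proof (modif_law (map2 g) k) as Hg; cbn in Hg.
cbn. set (m := modif (map2 f)) in *; set (n := modif (map2 g)) in *.
apply meq_eq.
apply meq_trans with (g :=
  leg2 (legs a) k ∘ ((on1 F k ◁ m i) ∘ (on1 F k ◁ (n i ▷ map1 f)))).
{ apply meq_vcomp; [constructor |]. rewrite <- lwhisk.
  apply meq_comp2; [constructor | apply meq_castr]. }
cbn; rewrite vcomp_assoc, Hf, <- !vcomp_assoc.
apply meq_vcomp; [constructor |].
apply meq_trans with (g := (leg2 (legs b) k ∘ (on1 F k ◁ n i)) ▷ map1 f).
- cbn; rewrite rwhisk. apply meq_vcomp; [constructor |].
  eapply meq_trans; [apply meq_castl | apply assoc2].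
- cbn; rewrite Hg, rwhisk.
  apply meq_vcomp; [constructor |]. apply meq_sym.
  eapply meq_trans; [apply meq_castl |].
  eapply meq_trans; [apply meq_castr |].
  eapply meq_trans; [rewrite <- comp2_idm; apply assoc2 |].
  apply meq_comp2; [apply meq_sym, meq_castr | constructor].
Defined.

Lemma cone_hcomp_law (a b c : cone) (g g' : cone_map b c) (f f' : cone_map a b)
    (t : cone_cell g g') (s : cone_cell f f') (i : J) :
  modif (map2 (cone_comp g' f')) i ∘ (leg (legs c) i ◁ (cell t ∗ cell s))
  = modif (map2 (cone_comp g f)) i.
Proof.
pose proof (cell_law t i) as Ht; pose proof (cell_law s i) as Hs.
cbn in *.
set (m := modif (map2 f) i) in *; set (n := modif (map2 g) i) in *.
set (m' := modif (map2 f') i) in *; set (n' := modif (map2 g') i) in *.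
apply meq_eq.
apply meq_trans with (g :=
  m' ∘ ((n' ▷ map1 f') ∘ ((leg (legs c) i ◁ cell t) ∗ cell s))).
- cbn; rewrite vcomp_assoc.
  apply meq_vcomp; [apply meq_castr | apply assoc2].
- apply meq_sym. eapply meq_trans; [apply meq_castr |]. apply meq_sym.
  rewrite <- interchange, vcomp_idl. cbn; rewrite Ht, comp2_rl.
  rewrite vcomp_assoc. apply meq_vcomp; [| constructor].
  apply eq_meq, Hs.
Qed.

Definition cone_hcomp (a b c : cone) :
  functor (prod_cat (cone_hom b c) (cone_hom a b)) (cone_hom a c).
Proof.
unshelve refine (@Functor (prod_cat (cone_hom b c) (cone_hom a b)) (cone_hom a c)
  (fun gf => cone_comp (fst gf) (snd gf)) _ _ _).
- intros gf gf' ts.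
  exact (@ConeCell a c (cone_comp (fst gf) (snd gf)) (cone_comp (fst gf') (snd gf'))
    (cell (fst ts) ∗ cell (snd ts)) (cone_hcomp_law (fst ts) (snd ts))).
- intros; apply cone_cell_eq, comp2_idm.
- intros; apply cone_cell_eq, interchange.
Defined.

Lemma cone_comp_idl (a b : cone) (f : cone_map a b) : cone_comp (cone_id b) f = f.
Proof.
apply cone_map_eq; [apply idl1 |]. intro i; cbn.
eapply meq_trans; [apply meq_castr |].
eapply meq_trans.
{ apply meq_vcomp; [constructor |].
  apply meq_comp2; [apply meq_cast' | constructor]. }
rewrite comp2_idm. apply eq_meq; exact (vcomp_idr _).
Qed.

Lemma cone_comp_idr (a b : cone) (f : cone_map a b) : cone_comp f (cone_id a) = f.
Proof.
apply cone_map_eq; [apply idr1 |]. intro i; cbn.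
eapply meq_trans; [apply meq_castr |].
eapply meq_trans; [apply meq_castl |]. apply idr2.
Qed.

Lemma cone_comp_assoc (a b c d : cone) (h : cone_map c d) (g : cone_map b c)
    (f : cone_map a b) :
  cone_comp h (cone_comp g f) = cone_comp (cone_comp h g) f.
Proof.
apply cone_map_eq; [apply assoc1 |]. intro i; cbn.
eapply meq_trans; [apply meq_castr |].
apply meq_sym. eapply meq_trans; [apply meq_castr |].
eapply meq_trans.
{ apply meq_vcomp; [constructor |].
  apply meq_comp2; [apply meq_castr | constructor]. }
rewrite rwhisk. apply meq_sym. rewrite <- !vcomp_assoc.
apply meq_vcomp; [constructor |].
apply meq_vcomp; [constructor |].
eapply meq_trans; [apply meq_castl |].
rewrite <- comp2_idm. apply assoc2.
Qed.

Definition cone_two_cat : two_cat.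
Proof.
refine (@TwoCat cone cone_hom cone_id cone_hcomp
  cone_comp_idl cone_comp_idr cone_comp_assoc _ _ _).
- intros x y f g s; apply cone_cell_meq; [apply cone_comp_idl .. | apply idl2].
- intros x y f g s; apply cone_cell_meq; [apply cone_comp_idr .. | apply idr2].
- intros; apply cone_cell_meq; [apply cone_comp_assoc .. | apply assoc2].
Defined.

Definition cone_proj : two_functor cone_two_cat C.
Proof.
unshelve refine (@TwoFunctor cone_two_cat C apex
  (fun x y => @Functor (cone_hom x y) (hom (apex x) (apex y))
    (@map1 x y) (fun f g s => cell s) _ _) _ _ _).
all: cbn; intros; constructor.
Defined.

End Cones.

(* Main.v *)
(** A 1-cell [(f, mu)] of the 2-category of cones is cartesian over [C] iff the
    modification [mu] is invertible.  If so, lifts along it are obtained by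
    composing with [mu^-1]; conversely, factoring [(f, id)] from the cone
    [beta f] through a cartesian [(f, mu)] over the identity gives a left inverse
    of [mu], which is two-sided because lifts are unique.  Hence a cartesian
    1-cell from [(x, alpha)] to [(l, lambda)] is an isomorphism from [lambda f]
    to [alpha]: one exists because precomposition with [lambda] is essentially
    surjective, and between any two there is exactly one 2-cell because it is
    fully faithful. *)
From Stdlib Require Import IndefiniteDescription.
Require Import Defs.

Set Implicit Arguments.
Unset Strict Implicit.
Unset Printing Implicit Defensive.

(** * Equivalences of categories: fullness, faithfulness, equivalence with the terminal category *)

Lemma iso_cancel_r (A : category) (a b c : A) (e : mor a b) (f g : mor b c) :
  is_iso e -> f ∘ e = g ∘ e -> f = g.
Proof.
intros [e' [_ He]] H.
rewrite <- (vcomp_idr f), <- (vcomp_idr g), <- He, !vcomp_assoc.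
now rewrite H.
Qed.

Lemma iso_cancel_l (A : category) (a b c : A) (e : mor b c) (f g : mor a b) :
  is_iso e -> e ∘ f = e ∘ g -> f = g.
Proof.
intros [e' [He _]] H.
rewrite <- (vcomp_idl f), <- (vcomp_idl g), <- He, <- !vcomp_assoc.
now rewrite H.
Qed.

(** Naturality of [eta] recovers [s] from [fmor G (fmor F s)] by cancelling [eta a]. Asking for one
    half of an equivalence lets it serve for [G] as well as for [F]. *)
Lemma retract_faithful (A B : category) (F : functor A B) (G : functor B A) :
  nat_iso (comp_functor G F) (id_functor A) ->
  forall (a b : A) (s t : mor a b), fmor F s = fmor F t -> s = t.
Proof.
intros [eta [nat iso]] a b s t H; cbn in nat.
apply (iso_cancel_r (iso a)); cbn.
now rewrite !nat, H.
Qed.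

Lemma equivalence_full (A B : category) (F : functor A B) (a b : A)
    (m : mor (F a) (F b)) :
  is_equivalence F -> exists s : mor a b, fmor F s = m.
Proof.
intros [G [[eta [nat iso]] FG]]; cbn in nat.
destruct (iso a) as [eta' [Ha _]]; cbn in *.
(* The preimage is the conjugate of [fmor G m] by [eta]; [G] is faithful, so the equation may be
   checked after applying [G]. *)
exists (eta b ∘ fmor G m ∘ eta').
apply (retract_faithful FG), (iso_cancel_l (iso b)).
rewrite <- nat, <- !vcomp_assoc, Ha.
now rewrite (vcomp_idr (fmor G m)).
Qed.

Lemma equivalent_terminal (A : category) (a0 : A) :
  (forall a b : A, exists s : mor a b, forall t : mor a b, t = s) ->
  equivalent A terminal_cat.
Proof.
intro H.
(* Choice is needed because the natural isomorphism has the family [s a0] as its components. *)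
set (s := fun a b : A => proj1_sig (constructive_indefinite_description _ (H a b))).
assert (S : forall (a b : A) (t : mor a b), t = s a b).
{ intros a b; exact (proj2_sig (constructive_indefinite_description _ (H a b))). }
assert (S2 : forall (a b : A) (t t' : mor a b), t = t').
{ intros; now rewrite (S _ _ t), (S _ _ t'). }
unshelve eexists (@Functor A terminal_cat (fun _ => tt) (fun _ _ _ => tt) _ _);
  try reflexivity.
unshelve eexists (@Functor terminal_cat A (fun _ => a0) (fun _ _ _ => idm a0) _ _).
- reflexivity.
- intros; now rewrite vcomp_idl.
- split.
  + exists (fun a => s a0 a); cbn; split; [intros; apply S2 |].
    intro a; exists (s a a0); split; apply S2.
  + exists (fun a => tt); split; [intros ? [] ?; reflexivity |].
    intros []; exists tt; now split.
Qed.

Definition const_functor (A B : category) (b : B) : functor A B.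
Proof.
refine (@Functor A B (fun _ => b) (fun _ _ _ => idm b) _ _).
- reflexivity.
- intros; now rewrite vcomp_idl.
Defined.

(** Objects are functors out of the terminal category, so it suffices to test the universal property
    there. *)
Lemma pullback_obj (A B C D : category) (P : functor A B) (Q : functor A C)
    (G : functor B D) (K : functor C D) (b : B) (c : C) :
  is_pullback P Q G K -> G b = K c ->
  exists a, (P a = b /\ Q a = c) /\ forall a', P a' = b -> Q a' = c -> a' = a.
Proof.
intros [_ H] e.
destruct (H terminal_cat (const_functor _ b) (const_functor _ c))
  as [U [[[U1 _] [U2 _]] U3]].
{ split; cbn; intros; [exact e |].
  rewrite !fmor_id; now apply meq_idm. }
exists (U tt); split; [split; [apply (U1 tt) | apply (U2 tt)] |].
intros a' <- <-.
refine (proj1 (U3 (const_functor _ a') _ _) tt); split; cbn; intros;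
  rewrite ?fmor_id; constructor.
Qed.

(** * Lifting along a cone map with invertible modification *)

Section ConeMaps.
Context (J : two_cat) (E : marking J) (C : two_cat) (F : two_functor J C).

Lemma cone_map_eq_modif (a b : cone E F) (f g : cone_map a b) (i : J) :
  f = g -> modif (map2 f) i ≡ modif (map2 g) i.
Proof. intros ->; constructor. Qed.

Lemma cone_comp_modif (a b c : cone E F) (g : cone_map b c) (f : cone_map a b)
    (i : J) :
  modif (map2 (cone_comp g f)) i
  ≡ modif (map2 f) i ∘ (modif (map2 g) i ▷ map1 f).
Proof. apply meq_castr. Qed.

Definition cone_iso (a b : cone E F) (f : cone_map a b) : Prop :=
  @is_iso (cone_cat E F (apex a)) (precomp (legs b) (map1 f)) (legs a) (map2 f).

Lemma whisk_assoc (a v : cone E F) (x : C) (f : hom x (apex v))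
    (h : cone_map a v) (g : hom (apex a) x) (e : map1 h = f · g) (i : J) :
  (leg (legs v) i · f) · g = leg (legs v) i · map1 h.
Proof. rewrite e; symmetry; apply assoc1. Qed.

(** The components are [h_i ∘ (nu_i g)], with [nu] meant as the inverse of the modification of [f].
    The two inverse laws enter separately: [nu ∘ mu = id] makes this a lift of [h], and
    [mu ∘ nu = id] makes it unique. *)
Definition cone_lift (a u v : cone E F) (f : cone_map u v)
    (nu : modification (legs u) (precomp (legs v) (map1 f)))
    (h : cone_map a v) (g : hom (apex a) (apex u)) (e : map1 h = map1 f · g) :
  cone_map a u.
Proof.
refine (@ConeMap _ _ _ _ a u g (@Modification _ _ _ _ _
  (precomp (legs u) g) (legs a)
  (fun i => modif (map2 h) i ∘ (id_of_eq (whisk_assoc e i) ∘ (modif nu i ▷ g))) _)).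
intros i j k.
pose proof (modif_law (map2 h) k) as Hh; cbn in Hh.
pose proof (modif_law nu k) as Hn; cbn in Hn.
cbn; rewrite !lwhisk.
etransitivity; [exact (vcomp_assoc _ _ _) |].
cbn; rewrite Hh, <- !vcomp_assoc; f_equal.
apply meq_eq, meq_sym.
eapply meq_trans; [apply meq_castl |].
apply meq_trans with (g := (modif nu j ∘ leg2 (legs u) k) ▷ g).
{ cbn; rewrite rwhisk; apply meq_vcomp; [constructor | apply meq_castr]. }
cbn; rewrite <- Hn, !rwhisk, <- !vcomp_assoc.
apply meq_vcomp.
- rewrite e, <- comp2_idm; apply meq_sym, assoc2.
- apply meq_sym. eapply meq_trans; [apply meq_castl |]. apply meq_sym.
  eapply meq_trans.
  { apply meq_vcomp; [| constructor].
    apply meq_comp2; [apply meq_cast | constructor]. }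
  cbn; rewrite comp2_idm, vcomp_idl, <- lwhisk.
  eapply meq_trans; [apply meq_sym, assoc2 |].
  apply meq_comp2; [constructor | apply meq_sym, meq_castl].
Defined.

Lemma cone_comp_lift (a u v : cone E F) (f : cone_map u v)
    (nu : modification (legs u) (precomp (legs v) (map1 f)))
    (h : cone_map a v) (g : hom (apex a) (apex u)) (e : map1 h = map1 f · g) :
  (forall i, modif nu i ∘ modif (map2 f) i = idm _) ->
  cone_comp f (cone_lift nu e) = h.
Proof.
intro H; apply cone_map_eq; [now symmetry |]; intro i.
eapply meq_trans; [apply cone_comp_modif |].
cbn; rewrite <- !vcomp_assoc, <- rwhisk.
eapply meq_trans; [| apply eq_meq, vcomp_idr].
apply meq_vcomp; [constructor |].
eapply meq_trans; [apply meq_castl |].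
cbn in H; rewrite H, comp2_idm; apply meq_idm, (whisk_assoc e).
Qed.

Lemma cone_lift_unique (a u v : cone E F) (f : cone_map u v)
    (nu : modification (legs u) (precomp (legs v) (map1 f)))
    (h : cone_map a v) (g : hom (apex a) (apex u)) (e : map1 h = map1 f · g)
    (n : cone_map a u) :
  (forall i, modif (map2 f) i ∘ modif nu i = idm _) ->
  cone_comp f n = h -> map1 n = g -> n = cone_lift nu e.
Proof.
intros H Hn <-; apply cone_map_eq; [reflexivity |]; intro i.
apply meq_sym.
apply meq_trans with
  (g := modif (map2 n) i ∘ (modif (map2 f) i ▷ map1 n) ∘ (modif nu i ▷ map1 n)).
- cbn; rewrite vcomp_assoc; apply meq_vcomp; [| constructor].
  eapply meq_trans; [apply meq_castr |].
  subst h; apply cone_comp_modif.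
- cbn; rewrite <- vcomp_assoc, <- rwhisk.
  cbn in H; rewrite H, comp2_idm; apply eq_meq; exact (vcomp_idr _).
Qed.

Lemma cone_lift_cell (a u v : cone E F) (f : cone_map u v)
    (nu : modification (legs u) (precomp (legs v) (map1 f)))
    (h h' : cone_map a v) (g g' : hom (apex a) (apex u))
    (e : map1 h = map1 f · g) (e' : map1 h' = map1 f · g')
    (s : cone_cell h h') (t : mor g g') :
  cell s ≡ map1 f ◁ t ->
  forall i, modif (map2 (cone_lift nu e')) i ∘ (leg (legs u) i ◁ t)
    = modif (map2 (cone_lift nu e)) i.
Proof.
intros st i; cbn.
pose proof (cell_law s i) as Hs; cbn in Hs.
rewrite <- Hs, <- !vcomp_assoc; f_equal.
apply meq_eq.
(* Interchange moves [t] past [nu_i]; what remains on the left is [v_i (f t)], which is [v_i s]. *)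
rewrite <- comp2_lr, comp2_rl, !vcomp_assoc.
apply meq_vcomp; [| constructor].
eapply meq_trans; [apply meq_castl |].
apply meq_sym; eapply meq_trans; [apply meq_castr |].
eapply meq_trans.
{ apply meq_comp2; [constructor | exact st]. }
cbn; rewrite <- comp2_idm; apply assoc2.
Qed.

Lemma cone_iso_cartesian (u v : cone E F) (f : cone_map u v) :
  cone_iso f -> @is_cartesian _ _ (cone_proj E F) u v f.
Proof.
intros [nu [H1 H2]].
assert (K1 : forall i, modif nu i ∘ modif (map2 f) i = idm _).
{ intro i; exact (f_equal (fun m => modif m i) H1). }
assert (K2 : forall i, modif (map2 f) i ∘ modif nu i = idm _).
{ intro i; exact (f_equal (fun m => modif m i) H2). }
intro a; split; [apply postcomp_square |].
intros X H L [HL1 HL2]; cbn in H, L, HL1, HL2.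
unshelve eexists.
(* A cell of cones is a 2-cell of [C] with a property, so on morphisms the lift is [L] itself and
   inherits its functor laws. *)
{ unshelve refine (@Functor X (cone_hom a u)
    (fun o => cone_lift nu (HL1 o))
    (fun o o' m => @ConeCell _ _ _ _ _ _ (cone_lift nu (HL1 o))
      (cone_lift nu (HL1 o')) (fmor L m)
      (cone_lift_cell nu (HL1 o) (HL1 o') (HL2 _ _ m))) _ _).
  - intros; apply cone_cell_eq, fmor_id.
  - intros; apply cone_cell_eq, fmor_comp. }
split; [split; split |].
- intro o; apply (cone_comp_lift (HL1 o) K1).
- intros o o' m; apply cone_cell_meq; [apply (cone_comp_lift (HL1 _) K1) .. |].
  apply meq_sym, HL2.
- reflexivity.
- constructor.
- intros V [V1 V2] [V3 V4]; cbn in V1, V2, V3, V4.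
  assert (Q : forall o, V o = cone_lift nu (HL1 o)).
  { intro o; apply (cone_lift_unique _ K2); auto. }
  split; [exact Q |].
  intros o o' m; apply cone_cell_meq; [apply Q .. | apply V4].
Qed.

(** * Inverting the modification of a cartesian cone map *)

Lemma cartesian_lift (a u v : cone E F) (f : cone_map u v) (h : cone_map a v)
    (g : hom (apex a) (apex u)) :
  @is_cartesian _ _ (cone_proj E F) u v f -> map1 h = map1 f · g ->
  exists n : cone_map a u, (cone_comp f n = h /\ map1 n = g) /\
    forall n', cone_comp f n' = h -> map1 n' = g -> n' = n.
Proof. intros Cf e; exact (pullback_obj (Cf a) e). Qed.

(** Since [map1 n] is only provably the identity, the components are corrected by the cast from
    [b_i] to [b_i (map1 n)]. *)
Definition modif_of_vertical (x : C) (a b : lax_cone E F x)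
    (n : cone_map (Cone a) (Cone b)) (e : map1 n = id1 x) : modification b a.
Proof.
refine (@Modification _ _ _ _ x b a (fun i => modif (map2 n) i ∘
  id_of_eq (eq_sym (eq_trans (f_equal (comp1 (leg b i)) e) (idr1 (leg b i))))) _).
intros i j k.
pose proof (modif_law (map2 n) k) as Hn; cbn in Hn.
cbn; rewrite lwhisk, vcomp_assoc, Hn, <- !vcomp_assoc; f_equal.
apply meq_eq, meq_sym.
eapply meq_trans; [apply meq_castl |].
apply meq_trans with (g := leg2 b k ∘ idm _).
{ apply eq_meq; symmetry; apply vcomp_idr. }
apply meq_vcomp.
- rewrite e; apply meq_sym, idr2.
- rewrite <- comp2_idm; apply meq_sym.
  eapply meq_trans; [apply meq_castl |].
  apply meq_comp2; [constructor | apply meq_cast].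
Defined.

Definition vertical_of_modif (x : C) (a b : cone_cat E F x) (m : mor b a) :
    cone_map (Cone a) (Cone b) :=
  @ConeMap _ _ _ _ (Cone a) (Cone b) (id1 x)
    (@vcomp (cone_cat E F x) (precomp b (id1 x)) b a m (map2 (cone_id (Cone b)))).

Lemma cartesian_cone_iso (u v : cone E F) (f : cone_map u v) :
  @is_cartesian _ _ (cone_proj E F) u v f -> cone_iso f.
Proof.
destruct u as [x u].
intro Cf.
set (w := precomp (legs v) (map1 f)).
set (h := @ConeMap _ _ _ _ (Cone w) v (map1 f) (@idm (cone_cat E F x) w)).
destruct (@cartesian_lift (Cone w) _ _ f h (id1 x) Cf) as [n [[n1 n2] _]].
{ symmetry; apply idr1. }
set (nu := modif_of_vertical n2).
exists nu.
assert (K1 : forall i, modif nu i ∘ modif (map2 f) i = idm _).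
{ intro i; apply meq_eq.
  apply meq_trans with (g := modif (map2 h) i); [| constructor].
  eapply meq_trans; [| exact (cone_map_eq_modif i n1)].
  apply meq_sym; eapply meq_trans; [apply cone_comp_modif |].
  apply meq_vcomp; [apply meq_sym, meq_castr |].
  rewrite n2; apply idr2. }
destruct (@cartesian_lift (Cone u) _ _ f f (id1 x) Cf) as [k [_ k3]].
{ symmetry; apply idr1. }
assert (K2 : forall i, modif (map2 f) i ∘ modif nu i = idm _).
(* Both [n'] and the identity are lifts of [f] through [f] over [id1 x], the former because
   [mu ∘ nu ∘ mu = mu] by [K1]; uniqueness identifies them. *)
{ set (n' := @vertical_of_modif x u u
    (@vcomp (cone_cat E F x) u w u (map2 f) nu)).
  assert (Q : n' = cone_id (Cone u)).
  { rewrite (k3 (cone_id (Cone u))); [apply k3 | apply cone_comp_idr |];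
      try reflexivity.
    apply cone_map_eq; [apply idr1 |]. intro i.
    eapply meq_trans; [apply cone_comp_modif |].
    apply meq_trans with
      (g := modif (map2 f) i ∘ modif nu i ∘ modif (map2 f) i).
    - apply meq_vcomp; [apply meq_castr | apply idr2].
    - cbn; rewrite <- vcomp_assoc; specialize (K1 i); cbn in K1; rewrite K1.
      apply eq_meq; exact (vcomp_idr _). }
  intro i; apply meq_eq.
  apply meq_trans with (g := modif (map2 n') i).
  - apply meq_sym, meq_castr.
  - rewrite Q; apply meq_cast'. }
split; apply modification_eq; assumption.
Qed.

End ConeMaps.

(** * Cartesian cone maps into the bilimit cone *)

Theorem corollary4p12 (J : two_cat) (E : marking J) (C : two_cat)
  (F : two_functor J C) (l : C) (lam : lax_cone E F l) :
  is_bilimit lam ->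
  @biterminal (cart_two_cat (cone_proj E F)) (Cone lam).
Proof.
intros bil [x a].
assert (f0 : exists f : cone_map (Cone a) (Cone lam), cone_iso f).
(* The component at [a] of the isomorphism from [lam · G(-)] to the identity is the required
   invertible modification. *)
{ destruct (bil x) as [G [_ [eps [_ iso]]]].
  exists (@ConeMap _ _ _ _ (Cone a) (Cone lam) (G a) (eps a)); exact (iso a). }
destruct f0 as [f0 Hf0].
refine (@equivalent_terminal (@hom (cart_two_cat (cone_proj E F)) (Cone a) (Cone lam))
  (exist _ f0 (cone_iso_cartesian Hf0)) _).
intros [f Cf] [g Cg]; cbn.
destruct (cartesian_cone_iso Cg) as [nu [H1 H2]].
(* The law of a cone cell asks for [mu_g ∘ (lam s) = mu_f], so [s] is taken as a preimage of
   [mu_g^-1 ∘ mu_f]. *)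
destruct (equivalence_full (F := precomp_functor lam x) (a := map1 f) (b := map1 g)
  (@vcomp (cone_cat E F x) _ _ _ nu (map2 f)) (bil x)) as [s Hs].
assert (S : forall i,
  modif (map2 g) i ∘ (leg (legs (Cone lam)) i ◁ s) = modif (map2 f) i).
{ intro i; refine (f_equal (fun m => modif m i)
    (_ : @vcomp (cone_cat E F x) _ _ _ (map2 g)
      (fmor (precomp_functor lam x) s) = map2 f)).
  rewrite Hs; etransitivity; [exact (vcomp_assoc _ _ _) |].
  etransitivity; [exact (f_equal (fun m => m ∘ _) H2) | exact (vcomp_idl _)]. }
exists (@ConeCell _ _ _ _ _ _ f g s S).
intro t; apply cone_cell_eq; cbn.
destruct (bil x) as [G [GF _]].
(* Faithfulness and cancellation of [mu_g] reduce uniqueness to the cell laws of [t] and [s], which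
   share the right-hand side [mu_f]. *)
apply (retract_faithful GF), (iso_cancel_l (A := cone_cat E F x) (e := map2 g)).
- now exists nu.
- apply modification_eq; intro i.
  transitivity (modif (map2 f) i); [apply (cell_law t) | symmetry; apply S].
Qed.
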